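(* Let $k,n\geq 2$ be integers and let $p,t>0$ be real numbers such that $pt=2^k$. The following are equivalent. (1) The inequality $\|f\|_{\mathrm{U}^k}\leq\|f\|_{\ell^p}$ holds for every function $f\colon\mathbb{Z}\to[0,\infty)$ supported in the set $\{0,1,2,\ldots,n-1\}$. (2) The inequality $\|f\|_{\mathrm{U}^k}\leq\|f\|_{\ell^p}$ holds for every integer $d\geq 0$ and every function $f\colon\mathbb{Z}^d\to\mathbb{C}$ supported in the discrete cube $\{0,1,2,\ldots,n-1\}^d$. (3) The inequality $P_k(A)\leq|A|^t$ holds for every integer $d\geq 0$ and every subset $A$ of the discrete cube $\{0,1,2,\ldots,n-1\}^d$. (4) There exists a constant $C\in(0,\infty)$ such that $P_k(A)\leq C|A|^t$ holds for every integer $d\geq 0$ and every subset $A$ of $\{0,1,2,\ldots,n-1\}^d$.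
   Context: For $p\in(0,\infty)$ and a finitely supported function $f\colon\mathbb{Z}^d\to\mathbb{C}$, $\|f\|_{\ell^p} := \big(\sum_{x\in\mathbb{Z}^d}|f(x)|^p\big)^{1/p}$. The Gowers uniformity norm of a finitely supported $f\colon\mathbb{Z}^d\to\mathbb{C}$ is \[ \|f\|_{\mathrm{U}^k} := \bigg( \sum_{a,h_1,\ldots,h_k\in\mathbb{Z}^d}\ \prod_{(\epsilon_1,\ldots,\epsilon_k)\in\{0,1\}^k} \mathcal{C}^{\epsilon_1+\cdots+\epsilon_k} f(a+\epsilon_1 h_1+\cdots+\epsilon_k h_k) \bigg)^{1/2^k}, \] where $\mathcal{C}\colon z\mapsto\bar z$ is complex conjugation. For a finite set $A\subset\mathbb{Z}^d$, \[ P_k(A) := \big|\big\{(a,h_1,\ldots,h_k)\in(\mathbb{Z}^d)^{k+1} : a+\epsilon_1h_1+\cdots+\epsilon_kh_k\in A \text{ for every } (\epsilon_1,\ldots,\epsilon_k)\in\{0,1\}^k\big\}\big|. \] The group $\mathbb{Z}^0$ is the trivial group consisting only of the neutral element, and $\{0,1,\ldots,n-1\}^0=\mathbb{Z}^0$. *)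

(* Defs.v *)
From mathcomp Require Import all_boot all_order all_algebra.
From mathcomp Require Import finmap.
From mathcomp Require Import complex.
From mathcomp Require Import boolp classical_sets functions cardinality fsbigop.
From mathcomp Require Import reals exp.

Set Implicit Arguments.
Unset Strict Implicit.
Unset Printing Implicit Defensive.

Import Order.TTheory GRing.Theory Num.Theory.

Local Open Scope classical_set_scope.
Local Open Scope ring_scope.

(* The group G below is int (for Z) or 'rV[int]_d (for Z^d, trivial when
   d = 0).  A sum \sum_(x \in A) F x is 0 by convention when F is nonzero at
   infinitely many points of A; this never happens below for p > 0 and finitely
   supported f. *)

Definition supported_in (G : zmodType) (V : zmodType) (f : G -> V)
    (S : set G) : Prop :=
  forall x, f x != 0 -> S x.

Definition lp_norm (R : realType) (G : zmodType) (p : R) (f : G -> R[i]) : R :=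
  (\sum_(x \in [set: G]) (ComplexField.Normc.normc (f x)) `^ p) `^ p^-1.

Definition vertex (G : zmodType) (k : nat) (a : G) (h : {ffun 'I_k -> G})
    (eps : {ffun 'I_k -> bool}) : G :=
  a + \sum_(i < k) h i *+ eps i.

Definition gowers_sum (R : realType) (G : zmodType) (k : nat)
    (f : G -> R[i]) : R[i] :=
  \sum_(ah \in [set: G * {ffun 'I_k -> G}])
    \prod_(eps : {ffun 'I_k -> bool})
      iter (\sum_(i < k) eps i)%N Num.conj (f (vertex ah.1 ah.2 eps)).

(* For k >= 1 and finitely supported f, the Gowers sum is a nonnegative real,
   so taking its real part only changes its type. *)
Definition gowers_norm (R : realType) (G : zmodType) (k : nat)
    (f : G -> R[i]) : R :=
  (complex.Re (gowers_sum k f)) `^ (2 ^+ k)^-1.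

(* The set is finite because A is: (a, h) is determined by a and the k points
   a + h i, all of which lie in A. *)
Definition num_parallelepipeds (G : zmodType) (k : nat) (A : {fset G}) : nat :=
  #|` fset_set [set ah : G * {ffun 'I_k -> G} |
        forall eps : {ffun 'I_k -> bool}, vertex ah.1 ah.2 eps \in A] |%fset.

Definition segment (n : nat) : set int := [set x | 0 <= x < n%:Z].

Definition cube (n d : nat) : set 'rV[int]_d :=
  [set v | forall i : 'I_d, segment n (v ord0 i)].

(* Main.v *)
Require Import Defs.
From mathcomp Require Import all_boot all_order all_algebra.
From mathcomp Require Import finmap.
From mathcomp Require Import complex.
From mathcomp Require Import boolp classical_sets functions cardinality fsbigop.
From mathcomp Require Import reals exp.
From mathcomp Require Import ring lra zify.

Import Order.TTheory GRing.Theory Num.Theory.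

Local Open Scope classical_set_scope.
Local Open Scope ring_scope.

(** Only the p-th power sum and the 2^k-th power of the Gowers norm matter:
    since p t = 2^k, the inequality of norms says that the Gowers sum of f is at
    most (\sum |f|^p)^t.

    All sums live on finite sets of parallelepipeds, so they can be computed in
    a finite group.  Modulo N = (k + 2) n a parallelepiped whose vertices have
    residues in {0, ..., n - 1} lifts to a unique one in Z with vertices in that
    segment: its sides are shorter than n, so its vertices are within k n of the
    base point and differ by less than N from every element of the segment
    ([int_freiman_model]).  The same holds coordinatewise in Z^d
    ([row_freiman_model]).  In a finite group the
    Gowers-Cauchy-Schwarz inequality [gowers_cauchy_schwarz] is obtained by
    applying the Cauchy-Schwarz inequality in each of the k directions.

    From (1) to (2): the Gowers sum of a complex f is nonnegative
    ([alternate_conj_ge0]) and is bounded by that of |f|.  For nonnegative f one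
    splits off one coordinate: the sum over the parallelepipeds of the remaining
    coordinates is a Gowers inner product of slices of f, which
    Gowers-Cauchy-Schwarz and induction bound by the product of the l^p norms of
    the slices; the function sending a coordinate to the l^p norm of its slice
    is one-dimensional and has the same l^p norm as f ([gowers_bound_split]).

    (3) is (2) for indicator functions, and (4) is a weakening of (3).

    From (4) to (1), the tensor power trick: f tensored d times is constant on
    each set of words with given letter counts, so it is a combination of at
    most (d + 1)^N indicator functions.  By Gowers-Cauchy-Schwarz its Gowers sum
    is at most C (d + 1)^(N 2^k) times the desired bound
    ([gowers_power_classes]).  Both sides are multiplicative in d, so taking
    d-th roots and letting d grow removes the polynomial factor
    ([exp_le_of_poly]). *)

(** * Parallelepipeds and Gowers inner products in a finite group *)

Definition set_coord {k : nat} (i : 'I_k) (b : bool) (eps : {ffun 'I_k -> bool}) :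
    {ffun 'I_k -> bool} :=
  [ffun j => if j == i then b else eps j].

Definition parallelepiped_prod {V : comPzRingType} {G : zmodType} {k : nat}
    (F : {ffun 'I_k -> bool} -> G -> V) (ah : G * {ffun 'I_k -> G}) : V :=
  \prod_eps F eps (vertex ah.1 ah.2 eps).

Definition gowers_inner {V : comPzRingType} {H : finZmodType} {k : nat}
    (F : {ffun 'I_k -> bool} -> H -> V) : V :=
  \sum_(ah : H * {ffun 'I_k -> H}) parallelepiped_prod F ah.

(** The 2^k-th power of the Gowers norm, for real-valued f, where conjugation is
    invisible. *)
Definition gowers_power {V : comPzRingType} {H : finZmodType} (k : nat)
    (f : H -> V) : V :=
  gowers_inner (fun _ : {ffun 'I_k -> bool} => f).

Lemma set_coord_at {k : nat} (i : 'I_k) (b : bool) (eps : {ffun 'I_k -> bool}) :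
  set_coord i b eps i = b.
Proof. by rewrite ffunE eqxx. Qed.

Lemma set_coord_id {k : nat} (i : 'I_k) (b : bool) (eps : {ffun 'I_k -> bool}) :
  eps i = b -> set_coord i b eps = eps.
Proof. by move=> eb; apply/ffunP => j; rewrite ffunE; case: eqP => // ->. Qed.

Lemma set_coordK {k : nat} (i : 'I_k) (b c : bool) (eps : {ffun 'I_k -> bool}) :
  set_coord i b (set_coord i c eps) = set_coord i b eps.
Proof. by apply/ffunP => j; rewrite !ffunE; case: eqP. Qed.

Definition shift_edge {G : zmodType} {k : nat} (i : 'I_k) (g : G)
    (h : {ffun 'I_k -> G}) : {ffun 'I_k -> G} :=
  [ffun j => if j == i then h j + g else h j].

Lemma shift_edge_bij {G : zmodType} {k : nat} (i : 'I_k) (g : G) :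
  bijective (@shift_edge G k i g).
Proof.
exists (shift_edge i (- g)) => h; apply/ffunP => j; rewrite !ffunE;
  by case: eqP; rewrite ?addrK ?subrK.
Qed.

Lemma vertex_lower {G : zmodType} {k : nat} (i : 'I_k) (g : G) (a : G) (h : {ffun 'I_k -> G})
    (eps : {ffun 'I_k -> bool}) :
  ~~ eps i -> vertex a (shift_edge i g h) eps = vertex a h eps.
Proof.
move=> /negbTE ei; congr (_ + _); apply: eq_bigr => j _; rewrite ffunE.
by case: eqP => // ->; rewrite ei.
Qed.

Lemma vertex_upper {G : zmodType} {k : nat} (i : 'I_k) (g : G) (a : G) (h : {ffun 'I_k -> G})
    (eps : {ffun 'I_k -> bool}) :
  ~~ eps i ->
  vertex a (shift_edge i g h) (set_coord i true eps) =
  vertex (a + h i + g) h eps.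
Proof.
move=> /negbTE ei; rewrite /vertex (bigD1 i)//= [in RHS](bigD1 i)//=.
rewrite !ffunE eqxx ei mulr1n mulr0n add0r !addrA; congr (_ + _).
by apply: eq_bigr => j /negbTE ji; rewrite !ffunE ji.
Qed.

Lemma prod_lower_upper {V : comPzRingType} {k : nat} (i : 'I_k)
    (P : {ffun 'I_k -> bool} -> V) :
  \prod_eps P eps =
  (\prod_(eps : {ffun 'I_k -> bool} | ~~ eps i) P eps) *
  \prod_(eps : {ffun 'I_k -> bool} | ~~ eps i) P (set_coord i true eps).
Proof.
rewrite (bigID (fun eps : {ffun 'I_k -> bool} => ~~ eps i))/=; congr (_ * _).
rewrite (reindex_onto (set_coord i true) (set_coord i false))/=.
  apply: eq_bigl => eps; rewrite set_coord_at /= set_coordK.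
  apply/eqP/idP => [<-|/negbTE]; first by rewrite set_coord_at.
  exact: set_coord_id.
by move=> eps /negPn ei; rewrite set_coordK set_coord_id.
Qed.

Definition lower_face_sum {V : comPzRingType} {H : finZmodType} {k : nat}
    (i : 'I_k) (F : {ffun 'I_k -> bool} -> H -> V) (h : {ffun 'I_k -> H}) : V :=
  \sum_a \prod_(eps : {ffun 'I_k -> bool} | ~~ eps i) F eps (vertex a h eps).

(** Parallelepipeds with given edges in the directions other than i are pairs of
    independent translates of their lower and upper faces in direction i, so
    their sum factors.  Summing over all h counts each such family #|H| times,
    once for each value of the unused edge h i. *)
Lemma gowers_inner_slice {V : comPzRingType} {H : finZmodType} {k : nat}
    (i : 'I_k) (F : {ffun 'I_k -> bool} -> H -> V) :
  #|H|%:R * gowers_inner F =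
  \sum_h lower_face_sum i F h *
         lower_face_sum i (fun eps => F (set_coord i true eps)) h.
Proof.
rewrite /gowers_inner.
under eq_bigr do rewrite /parallelepiped_prod.
rewrite -(pair_bigA _ (fun a h => \prod_eps F eps (vertex a h eps)))/=.
rewrite exchange_big /=.
set S := fun h => \sum_a \prod_eps F eps (vertex a h eps).
transitivity (\sum_(g : H) \sum_h S (shift_edge i g h)).
  rewrite mulr_natl -sumr_const; apply: eq_bigr => g _.
  by rewrite [LHS](reindex (shift_edge i g))//; exact/onW_bij/shift_edge_bij.
(* After averaging over the translations g of the edge i, the upper face sits
   at the base point a + h i + g, which is independent of a. *)
rewrite exchange_big; apply: eq_bigr => h _ /=; rewrite exchange_big /=.
rewrite mulr_suml; apply: eq_bigr => a _.
under eq_bigr => g _.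
  rewrite (prod_lower_upper i).
  under eq_bigr => eps ei do rewrite vertex_lower//.
  under [X in _ * X]eq_bigr => eps ei do rewrite vertex_upper//.
  over.
rewrite -mulr_sumr; congr (_ * _).
by rewrite /lower_face_sum [RHS](reindex_inj (@addrI _ (a + h i))).
Qed.

Lemma sum_mul_sqr_le {R : realFieldType} {I : finType} (x y : I -> R) :
  (\sum_i x i * y i) ^+ 2 <= (\sum_i x i * x i) * (\sum_i y i * y i).
Proof.
(* Lagrange's identity *)
suff -> : (\sum_i x i * x i) * (\sum_i y i * y i) =
    (\sum_i x i * y i) ^+ 2 +
    2^-1 * \sum_i \sum_j (x i * y j - x j * y i) ^+ 2.
  rewrite lerDl; apply: mulr_ge0; first by rewrite invr_ge0.
  by apply: sumr_ge0 => i _; apply: sumr_ge0 => j _; exact: sqr_ge0.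
have E : \sum_i \sum_j (x i * y j - x j * y i) ^+ 2 =
   \sum_i \sum_j (x i * x i * (y j * y j)) + \sum_i \sum_j (y i * y i * (x j * x j))
   - 2 * \sum_i \sum_j ((x i * y i) * (x j * y j)).
  rewrite mulr_sumr -!big_split -sumrB /=; apply: eq_bigr => i _.
  by rewrite mulr_sumr -big_split -sumrB /=; apply: eq_bigr => j _; ring.
rewrite {}E.
have D (u v : I -> R) : \sum_i \sum_j (u i * v j) = (\sum_i u i) * (\sum_i v i).
  by rewrite mulr_suml; apply: eq_bigr => i _; rewrite mulr_sumr.
by rewrite !D; field.
Qed.

Lemma card_finZmod_gt0 (H : finZmodType) : (0 < #|H|)%N.
Proof. by apply/card_gt0P; exists 0. Qed.

(** Cauchy-Schwarz over h in the factorization [gowers_inner_slice]; the two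
    resulting sums of squares are again factorizations of that form. *)
Lemma gowers_inner_sqr_le {R : realFieldType} {H : finZmodType} {k : nat}
    (i : 'I_k) (F : {ffun 'I_k -> bool} -> H -> R) :
  gowers_inner F ^+ 2 <=
  gowers_inner (fun eps => F (set_coord i false eps)) *
  gowers_inner (fun eps => F (set_coord i true eps)).
Proof.
have H0 : 0 < #|H|%:R :> R by rewrite ltr0n card_finZmod_gt0.
rewrite -(ler_pM2l (mulr_gt0 H0 H0)) expr2 mulrACA [leRHS]mulrACA -expr2.
rewrite !(gowers_inner_slice i).
apply: le_trans (sum_mul_sqr_le _ _) _.
rewrite le_eqVlt; apply/orP; left; apply/eqP.
congr (_ * _); apply: eq_bigr => h _; congr (_ * _);
  apply: eq_bigr => a _; apply: eq_bigr => eps ei;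
  by rewrite ?set_coordK // set_coord_id //; apply/negbTE.
Qed.

Lemma gowers_inner_ge0 {R : realFieldType} {H : finZmodType} {k : nat}
    (F : {ffun 'I_k -> bool} -> H -> R) :
  (forall eps x, 0 <= F eps x) -> 0 <= gowers_inner F.
Proof. by move=> F0; apply: sumr_ge0 => ah _; apply: prodr_ge0. Qed.

(** Interpolates between eps and eta: the first j directions have already been
    treated by Cauchy-Schwarz and are frozen at eta. *)
Definition hybrid {k : nat} (j : nat) (eta eps : {ffun 'I_k -> bool}) :
    {ffun 'I_k -> bool} :=
  [ffun i : 'I_k => if (i < j)%N then eta i else eps i].

Lemma hybrid_set_coord {k : nat} (i : 'I_k) b (eta eps : {ffun 'I_k -> bool}) :
  hybrid i eta (set_coord i b eps) = hybrid i.+1 (set_coord i b eta) eps.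
Proof.
apply/ffunP => j; rewrite !ffunE ltnS -val_eqE /=.
by case: (ltngtP j i).
Qed.

Lemma prod_set_coord {V : comPzRingType} {k : nat} (i : 'I_k)
    (P : {ffun 'I_k -> bool} -> V) :
  \prod_eps (P (set_coord i false eps) * P (set_coord i true eps)) =
  (\prod_eps P eps) ^+ 2.
Proof.
rewrite (prod_lower_upper i) (prod_lower_upper i P) expr2; congr (_ * _);
  rewrite -big_split; apply: eq_bigr => eps /negbTE ei;
  by rewrite ?set_coordK (set_coord_id _ _ _ ei).
Qed.

(** The products M j over eta of the hybrids at stage j increase with j, by
    Cauchy-Schwarz in direction j; M 0 is the left-hand side, as nothing is
    frozen, and M k is the right-hand side, as everything is. *)
Lemma gowers_cauchy_schwarz {R : realFieldType} {H : finZmodType} {k : nat}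
    (F : {ffun 'I_k -> bool} -> H -> R) :
  (forall eps x, 0 <= F eps x) ->
  gowers_inner F ^+ (2 ^ k) <=
  \prod_(eta : {ffun 'I_k -> bool}) gowers_power k (F eta).
Proof.
move=> F0.
pose M j := \prod_(eta : {ffun 'I_k -> bool}) gowers_inner (fun eps => F (hybrid j eta eps)).
have M_ge0 j : 0 <= M j by apply: prodr_ge0 => eta _; exact: gowers_inner_ge0.
have M_step (i : 'I_k) : M i <= M i.+1.
  (* Squaring matches the pair of factors given by Cauchy-Schwarz: as eta
     varies, its two settings of coordinate i cover every index twice. *)
  rewrite -(@ler_pXn2r _ 2)// ?nnegrE// /M.
  rewrite -[leRHS](prod_set_coord i) -prodrXl.
  apply: ler_prod => eta _; rewrite sqr_ge0/=.
  apply: le_trans (gowers_inner_sqr_le i _) _.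
  by rewrite le_eqVlt; apply/orP; left; apply/eqP; congr (_ * _);
    apply: eq_bigr => ah _; apply: eq_bigr => eps _; rewrite hybrid_set_coord.
have M_le j : (j <= k)%N -> M 0 <= M j.
  elim: j => // j IH jk; apply: le_trans (IH (ltnW jk)) (M_step (Ordinal jk)).
have hyb0 eta : @hybrid k 0 eta = id.
  by apply/funext => eps; apply/ffunP => i; rewrite ffunE.
have hybk eta : @hybrid k k eta = fun=> eta.
  by apply/funext => eps; apply/ffunP => i; rewrite ffunE ltn_ord.
have := M_le k (leqnn k); rewrite /M.
under eq_bigr do rewrite hyb0.
under [X in _ <= X]eq_bigr do rewrite hybk.
by rewrite prodr_const card_ffun card_bool card_ord.
Qed.

(** The form of Gowers-Cauchy-Schwarz that avoids 2^k-th roots: b eps stands for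
    any bound on the Gowers norm of F eps. *)
Lemma gowers_inner_le {R : realFieldType} {H : finZmodType} {k : nat}
    (F : {ffun 'I_k -> bool} -> H -> R) (b : {ffun 'I_k -> bool} -> R) :
  (forall eps x, 0 <= F eps x) -> (forall eps, 0 <= b eps) ->
  (forall eps, gowers_power k (F eps) <= b eps ^+ (2 ^ k)) ->
  gowers_inner F <= \prod_eps b eps.
Proof.
move=> F0 b0 Fb.
rewrite -(@ler_pXn2r _ (2 ^ k)%N) ?expn_gt0// ?nnegrE ?prodr_ge0 ?gowers_inner_ge0//.
apply: le_trans (gowers_cauchy_schwarz _ F0) _; rewrite -prodrXl.
by apply: ler_prod => eps _; rewrite gowers_inner_ge0/=.
Qed.

(** * Splitting a product group *)

Lemma vertex_split {G1 G2 G : zmodType} (c : G1 -> G2 -> G)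
    (cD : forall x x' y y', c (x + x') (y + y') = c x y + c x' y') {k : nat}
    (a : G1) (b : G2) (h : {ffun 'I_k -> G1}) (g : {ffun 'I_k -> G2})
    (eps : {ffun 'I_k -> bool}) :
  vertex (c a b) [ffun i => c (h i) (g i)] eps =
  c (vertex a h eps) (vertex b g eps).
Proof.
have c0 : c 0 0 = 0 by apply: (addrI (c 0 0)); rewrite -cD !addr0.
rewrite /vertex cD; congr (_ + _).
have cS : forall r : seq 'I_k,
    c (\sum_(i <- r) h i *+ eps i) (\sum_(i <- r) g i *+ eps i) =
    \sum_(i <- r) c (h i) (g i) *+ eps i.
  elim=> [|i r IH]; first by rewrite !big_nil.
  by rewrite !big_cons cD IH; case: (eps i); rewrite ?mulr1n// !mulr0n c0.
by rewrite cS; apply: eq_bigr => i _; rewrite ffunE.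
Qed.

Lemma sum_split {V : nmodType} {H1 H2 H : finType} (c : H1 -> H2 -> H)
    (c_bij : bijective (fun z => c z.1 z.2)) (F : H -> V) :
  \sum_z F z = \sum_x \sum_y F (c x y).
Proof.
rewrite pair_bigA [LHS](reindex (fun z : H1 * H2 => c z.1 z.2))//.
exact: onW_bij.
Qed.

(** A parallelepiped of a product is a pair of parallelepipeds of the factors.
    The product is given by an additive bijection c, so that the lemma applies
    to row vectors with one coordinate split off. *)
Lemma gowers_inner_split {V : comPzRingType} {H1 H2 H : finZmodType}
    (c : H1 -> H2 -> H)
    (cD : forall x x' y y', c (x + x') (y + y') = c x y + c x' y')
    (c_bij : bijective (fun z => c z.1 z.2)) {k : nat}
    (F : {ffun 'I_k -> bool} -> H -> V) :
  gowers_inner F =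
  \sum_(ah : H1 * {ffun 'I_k -> H1})
    gowers_inner (fun eps y => F eps (c (vertex ah.1 ah.2 eps) y)).
Proof.
case: (c_bij) => s cK sK.
rewrite /gowers_inner pair_bigA /=.
pose join (q : (H1 * {ffun 'I_k -> H1}) * (H2 * {ffun 'I_k -> H2})) :
    H * {ffun 'I_k -> H} :=
  (c q.1.1 q.2.1, [ffun i => c (q.1.2 i) (q.2.2 i)]).
have join_bij : bijective join.
  exists (fun r : H * {ffun 'I_k -> H} => (((s r.1).1, [ffun i => (s (r.2 i)).1]),
      ((s r.1).2, [ffun i => (s (r.2 i)).2]))).
    case=> [[a h] [b g]] /=; rewrite (cK (a, b))/=.
    by congr ((_, _), (_, _)); apply/ffunP => i; rewrite !ffunE (cK (_, _)).
  case=> a h /=; rewrite /join /= sK; congr (_, _).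
  by apply/ffunP => i; rewrite !ffunE sK.
rewrite (reindex join) /=; last exact: onW_bij.
apply: eq_bigr => -[[a h] [b g]] _ /=; apply: eq_bigr => eps _ /=.
by rewrite vertex_split.
Qed.

(** The inequality between the Gowers norm and the l^p norm, raised to the power
    2^k = p t, for nonnegative functions supported in S. *)
Definition gowers_bound {R : realType} {H : finZmodType} (k : nat) (p t : R)
    (S : H -> Prop) : Prop :=
  forall f : H -> R, (forall x, 0 <= f x) -> (forall x, f x != 0 -> S x) ->
  gowers_power k f <= (\sum_x f x `^ p) `^ t.

Lemma powR_invK {R : realType} (p x : R) : 0 < p -> 0 <= x ->
  (x `^ p^-1) `^ p = x.
Proof. by move=> p0 x0; rewrite -powRrM mulVf ?gt_eqF// powRr1. Qed.

Lemma powR_inv_exp {R : realType} (k : nat) (p t x : R) : 0 < p ->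
  p * t = 2 ^+ k -> 0 <= x -> (x `^ p^-1) ^+ (2 ^ k) = x `^ t.
Proof.
move=> p0 pt x0; rewrite -powR_mulrn ?powR_ge0// natrX -pt -powRrM.
by rewrite mulrA mulVf ?gt_eqF// mul1r.
Qed.

Lemma sum_powR_ge0 {R : realType} {I : finType} (p : R) (f : I -> R) :
  0 <= \sum_x f x `^ p.
Proof. by apply: sumr_ge0 => x _; exact: powR_ge0. Qed.

(** With b x the l^p norm of the slice of f at x, Gowers-Cauchy-Schwarz and the
    bound on the second factor give, for each parallelepiped of the first
    factor, a contribution of at most the product of b over its vertices; the
    bound on the first factor then applies to b. *)
Lemma gowers_bound_split {R : realType} {H1 H2 H : finZmodType} (k : nat)
    (p t : R) (p_gt0 : 0 < p) (pt : p * t = 2 ^+ k) (c : H1 -> H2 -> H)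
    (cD : forall x x' y y', c (x + x') (y + y') = c x y + c x' y')
    (c_bij : bijective (fun z => c z.1 z.2))
    (S1 : H1 -> Prop) (S2 : H2 -> Prop) (S : H -> Prop)
    (cS : forall x y, S (c x y) -> S1 x /\ S2 y) :
  gowers_bound k p t S1 -> gowers_bound k p t S2 -> gowers_bound k p t S.
Proof.
move=> B1 B2 f f0 fS.
pose N x := \sum_y f (c x y) `^ p.
have N0 x : 0 <= N x by exact: sum_powR_ge0.
pose b x := N x `^ p^-1.
have b0 x : 0 <= b x by exact: powR_ge0.
apply: (@le_trans _ _ (gowers_power k b)).
  rewrite /gowers_power (gowers_inner_split c cD c_bij).
  apply: ler_sum => ah _; apply: gowers_inner_le => //= eps.
  rewrite (powR_inv_exp k p t)//; apply: B2 => // y fy.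
  by have [] := cS _ _ (fS _ fy).
have -> : \sum_z f z `^ p = \sum_x b x `^ p.
  rewrite (sum_split c c_bij); apply: eq_bigr => x _.
  by rewrite powR_invK.
apply: B1 => // x bx.
have [y fy] : exists y, f (c x y) != 0.
  apply/not_existsP => fx0; move/eqP: bx; apply.
  rewrite /b /N big1 ?powR0 ?invr_eq0 ?gt_eqF// => y _.
  have /negP/negPn/eqP-> := fx0 y.
  by rewrite powR0// gt_eqF.
by have [] := cS _ _ (fS _ fy).
Qed.

Definition cons_row {V : nmodType} {d : nat} (x : V) (w : 'rV[V]_d) : 'rV[V]_d.+1 :=
  \row_j oapp (w 0) x (unlift ord0 j).

Lemma cons_row0 {V : nmodType} {d : nat} (x : V) (w : 'rV[V]_d) :
  cons_row x w 0 ord0 = x.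
Proof. by rewrite mxE unlift_none. Qed.

Lemma cons_row_lift {V : nmodType} {d : nat} (x : V) (w : 'rV[V]_d) i :
  cons_row x w 0 (lift ord0 i) = w 0 i.
Proof. by rewrite mxE liftK. Qed.

Lemma cons_rowD {V : nmodType} {d : nat} (x x' : V) (w w' : 'rV[V]_d) :
  cons_row (x + x') (w + w') = cons_row x w + cons_row x' w'.
Proof.
by apply/rowP => j; rewrite !mxE; case: unliftP => [i|] _ //=; rewrite mxE.
Qed.

Lemma cons_row_bij {V : nmodType} {d : nat} :
  bijective (fun z : V * 'rV[V]_d => cons_row z.1 z.2).
Proof.
exists (fun v : 'rV[V]_d.+1 => (v 0 ord0, \row_i v 0 (lift ord0 i))) => [[x w]|v] /=.
  by rewrite cons_row0; congr (_, _); apply/rowP => i; rewrite mxE cons_row_lift.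
by apply/rowP => j; rewrite mxE; case: unliftP => [i|] -> //=; rewrite mxE.
Qed.

Lemma rV0_eq {Z : Type} (u v : 'rV[Z]_0) : u = v.
Proof. by apply/rowP => -[]. Qed.

Lemma sum_rV0 {V : nmodType} {Z : finZmodType} (F : 'rV[Z]_0 -> V) :
  \sum_v F v = F 0.
Proof.
rewrite (bigD1 0)//= big1 ?addr0// => v /eqP[]; exact: rV0_eq.
Qed.

Lemma gowers_power_rV0 {V : comPzRingType} {Z : finZmodType} (k : nat)
    (f : 'rV[Z]_0 -> V) : gowers_power k f = f 0 ^+ (2 ^ k).
Proof.
rewrite /gowers_power /gowers_inner.
rewrite (bigD1 (0, [ffun=> 0]))//= [X in _ + X]big1 ?addr0; last first.
  move=> [a h] /eqP[]; congr (_, _); first exact: rV0_eq.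
  by apply/ffunP => i; exact: rV0_eq.
rewrite /parallelepiped_prod (eq_bigr (fun=> f 0)).
  by rewrite prodr_const card_ffun card_bool card_ord.
by move=> eps _; congr f; exact: rV0_eq.
Qed.

Lemma gowers_bound_rV {R : realType} {Z : finZmodType} (k : nat) (p t : R)
    (p_gt0 : 0 < p) (pt : p * t = 2 ^+ k) (S : Z -> Prop) (d : nat) :
  gowers_bound k p t S ->
  gowers_bound k p t (fun v : 'rV[Z]_d => forall i, S (v 0 i)).
Proof.
move=> BS; elim: d => [|d IH].
  (* In dimension 0 there is a single parallelepiped and the bound is an equality. *)
  move=> f f0 _; rewrite gowers_power_rV0 sum_rV0 -powRrM pt -natrX.
  by rewrite powR_mulrn.
apply: (gowers_bound_split k p t p_gt0 pt cons_row cons_rowD cons_row_bij _ _ _ _ BS IH).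
move=> x w xwS; split=> [|i]; first by have := xwS ord0; rewrite cons_row0.
by have := xwS (lift ord0 i); rewrite cons_row_lift.
Qed.

(** * Tensor powers and indicator functions *)

Definition tensor_power {V : comPzRingType} {Z : Type} (d : nat) (f : Z -> V)
    (v : 'rV[Z]_d) : V := \prod_i f (v 0 i).

Lemma tensor_power_cons {V : comPzRingType} {Z : nmodType} {d : nat} (f : Z -> V)
    (x : Z) (w : 'rV[Z]_d) :
  tensor_power d.+1 f (cons_row x w) = f x * tensor_power d f w.
Proof.
rewrite /tensor_power big_ord_recl cons_row0; congr (_ * _).
by apply: eq_bigr => i _; rewrite cons_row_lift.
Qed.

Lemma gowers_power_tensor {V : comPzRingType} {Z : finZmodType} (k d : nat)
    (f : Z -> V) :
  gowers_power k (tensor_power d f) = gowers_power k f ^+ d.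
Proof.
elim: d => [|d IH].
  by rewrite gowers_power_rV0 /tensor_power big_ord0 expr1n.
rewrite /gowers_power (gowers_inner_split cons_row cons_rowD cons_row_bij) exprS -IH.
rewrite mulr_suml; apply: eq_bigr => ah _; rewrite mulr_sumr.
apply: eq_bigr => bg _; rewrite -big_split /=; apply: eq_bigr => eps _.
by rewrite tensor_power_cons.
Qed.

Lemma sum_tensor_power {V : comPzRingType} {Z : finZmodType} (d : nat)
    (f : Z -> V) :
  \sum_v tensor_power d f v = (\sum_x f x) ^+ d.
Proof.
elim: d => [|d IH]; first by rewrite sum_rV0 /tensor_power big_ord0 expr0.
rewrite (sum_split cons_row cons_row_bij) exprS -IH mulr_suml.
apply: eq_bigr => x _; rewrite mulr_sumr; apply: eq_bigr => w _.
by rewrite tensor_power_cons.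
Qed.

Lemma tensor_power_powR {R : realType} {Z : Type} (d : nat) (f : Z -> R) (p : R)
    (v : 'rV[Z]_d) : (forall x, 0 <= f x) ->
  tensor_power d f v `^ p = tensor_power d (fun x => f x `^ p) v.
Proof.
move=> f0; rewrite /tensor_power.
elim: (index_enum _) => [|i r IH]; first by rewrite !big_nil powR1.
by rewrite !big_cons powRM ?IH// prodr_ge0.
Qed.

(** The type of a word, in the sense of the method of types.  Its values are
    stored in 'I_d.+1 so that there are visibly (d + 1)^#|Z| types. *)
Definition letter_counts {Z : finType} {d : nat} (v : 'rV[Z]_d) :
    {ffun Z -> 'I_d.+1} := [ffun x => inord #|[pred i | v 0 i == x]|].

Lemma tensor_power_counts {V : comPzRingType} {Z : finType} {d : nat}
    (f : Z -> V) (v : 'rV[Z]_d) :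
  tensor_power d f v = \prod_x f x ^+ letter_counts v x.
Proof.
rewrite /tensor_power (partition_big (fun i => v 0 i) xpredT)//=.
apply: eq_bigr => x _; rewrite ffunE inordK; last first.
  by rewrite ltnS -[leqRHS]card_ord; exact: max_card.
rewrite (eq_bigr (fun=> f x)); last by move=> i /eqP->.
by rewrite prodr_const; congr (_ ^+ _); apply: eq_card => i; rewrite !inE.
Qed.

Lemma gowers_power_scale {V : comPzRingType} {H : finZmodType} (k : nat) (w : V)
    (f : H -> V) :
  gowers_power k (fun x => w * f x) = w ^+ (2 ^ k) * gowers_power k f.
Proof.
rewrite /gowers_power /gowers_inner mulr_sumr; apply: eq_bigr => ah _.
rewrite /parallelepiped_prod big_split /= prodr_const.
by rewrite card_ffun card_bool card_ord.
Qed.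

Lemma gowers_power_sum {V : comPzRingType} {H : finZmodType} {T : finType} (k : nat)
    (g : T -> H -> V) :
  gowers_power k (fun x => \sum_tau g tau x) =
  \sum_(u : {ffun {ffun 'I_k -> bool} -> T}) gowers_inner (fun eps => g (u eps)).
Proof.
rewrite /gowers_power /gowers_inner [RHS]exchange_big; apply: eq_bigr => ah _.
exact: bigA_distr_bigA.
Qed.

(** If f takes a single value on each class of tau in S, it is a combination of
    #|T| indicator functions.  Each term has Gowers norm at most m, by the bound
    for sets and because its l^p norm is at most that of f.  Expanding the
    product over the 2^k vertices leaves #|T| ^ 2^k Gowers inner products, each
    at most m ^ 2^k. *)
Lemma gowers_power_classes {R : realType} {H : finZmodType} {T : finType} (k : nat)
    (p t C : R) (p_gt0 : 0 < p) (t_gt0 : 0 < t) (pt : p * t = 2 ^+ k) (C_gt0 : 0 < C)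
    (S : {set H})
    (BC : forall B : {set H}, B \subset S ->
      gowers_power k (fun x => (x \in B)%:R) <= C * #|B|%:R `^ t)
    (f : H -> R) (tau : H -> T) (w : T -> R) :
  (forall x, f x != 0 -> x \in S) -> (forall u, 0 <= w u) ->
  (forall x, x \in S -> f x = w (tau x)) ->
  gowers_power k f <= C * #|T|%:R ^+ (2 ^ k) * (\sum_x f x `^ p) `^ t.
Proof.
move=> fS w0 fw.
have K0 : (0 < 2 ^ k)%N by rewrite expn_gt0.
pose B u := [set x in S | tau x == u]%SET.
pose m := C `^ ((2 ^ k)%N%:R^-1) * (\sum_x f x `^ p) `^ p^-1.
have m0 : 0 <= m by rewrite mulr_ge0 ?powR_ge0.
have mE : m ^+ (2 ^ k) = C * (\sum_x f x `^ p) `^ t.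
  rewrite exprMn (powR_inv_exp k p t)// ?sum_powR_ge0//; congr (_ * _).
  rewrite -powR_mulrn ?powR_ge0// -powRrM mulVf ?powRr1 ?ltW//.
  by rewrite pnatr_eq0 -lt0n.
have fE : f = fun x => \sum_u w u * (x \in B u)%:R.
  apply/funext => x; rewrite (bigD1 (tau x))//= [X in _ + X]big1 ?addr0.
    rewrite inE eqxx andbT; have [xS|xS] := boolP (x \in S).
      by rewrite mulr1 fw.
    by rewrite mulr0; apply/eqP; apply: contraNT xS => /fS.
  by move=> u /negbTE ux; rewrite inE eq_sym ux andbF mulr0.
rewrite {1}fE gowers_power_sum.
apply: (@le_trans _ _ (\sum_(u : {ffun {ffun 'I_k -> bool} -> T}) m ^+ (2 ^ k))).
  apply: ler_sum => u _.
  rewrite -[X in m ^+ (X ^ _)]card_bool -[X in m ^+ (_ ^ X)]card_ord -card_ffun -prodr_const.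
  apply: gowers_inner_le => // eps.
    by move=> x; rewrite mulr_ge0.
  rewrite gowers_power_scale mE; set v := u eps.
  have BS : B v \subset S by apply/fintype.subsetP => x; rewrite inE => /andP[].
  apply: le_trans (ler_wpM2l _ (BC _ BS)) _; first exact: exprn_ge0.
  rewrite mulrCA ler_pM2l//.
  have -> : w v ^+ (2 ^ k) = (w v `^ p) `^ t.
    by rewrite -powRrM pt -natrX powR_mulrn.
  rewrite -powRM ?powR_ge0//; apply: ge0_ler_powR; first exact: ltW.
  - by rewrite nnegrE mulr_ge0 ?powR_ge0.
  - by rewrite nnegrE sum_powR_ge0.
  rewrite (bigID (mem (B v)))/= mulr_natr -sumr_const.
  rewrite (eq_bigr (fun x => f x `^ p)); last first.
    by move=> x; rewrite inE => /andP[xS /eqP xv]; rewrite fw// xv.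
  by rewrite lerDl; apply: sumr_ge0 => x _; exact: powR_ge0.
rewrite sumr_const mE -[leLHS]mulr_natr card_ffun card_ffun card_bool card_ord natrX.
by rewrite mulrAC.
Qed.

(** Otherwise r = x / y > 1 has r ^ d <= C (d + 1)^M for all d.  With s the
    (M + 1)-st root of r, Bernoulli's inequality gives s ^ d >= e (d + 1) for
    some e > 0, so that r ^ d grows at least like (d + 1)^(M + 1). *)
Lemma exp_le_of_poly {R : realType} (C x y : R) (M : nat) : 0 <= x -> 0 <= y -> 0 < C ->
  (forall d, x ^+ d <= C * d.+1%:R ^+ M * y ^+ d) -> x <= y.
Proof.
move=> x0 y0 C0 H; rewrite leNgt; apply/negP => yx.
have [y_eq0|y_neq0] := eqVneq y 0.
  by have := H 1%N; rewrite y_eq0 !expr1 mulr0 leNgt -y_eq0 yx.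
have yp : 0 < y by rewrite lt_def y_neq0.
pose r := x / y.
have r1 : 1 < r by rewrite ltr_pdivlMr// mul1r.
have Hr d : r ^+ d <= C * d.+1%:R ^+ M.
  by rewrite expr_div_n ler_pdivrMr ?exprn_gt0.
pose s := r `^ M.+1%:R^-1.
have rE : r = s ^+ M.+1.
  by rewrite -powR_mulrn ?powR_ge0// -powRrM mulVf ?pnatr_eq0// powRr1// ltW// (lt_trans ltr01).
have s1 : 1 < s.
  rewrite ltNge; apply/negP => s1; move: r1; rewrite rE ltNge.
  by rewrite exprn_ile1// powR_ge0.
pose e := Num.min 1 (s - 1).
have e0 : 0 < e by rewrite lt_min ltr01 subr_gt0.
have bern d : e * d.+1%:R <= s ^+ d.
  elim: d => [|d IH]; first by rewrite mulr1 expr0 ge_min lexx.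
  have sd1 : 1 <= s ^+ d by rewrite exprn_ege1// ltW.
  have es : e <= s - 1 by rewrite ge_min lexx orbT.
  rewrite exprS -natr1 mulrDr mulr1.
  have := ler_wpM2r (le_trans ler01 sd1) es.
  have := ler_wpM2l (ltW e0) sd1.
  lra.
pose D := Num.bound (C / e ^+ M.+1).
have := Hr D; rewrite rE -exprM mulnC exprM.
have := @ler_pXn2r _ M.+1 isT (e * D.+1%:R) (s ^+ D).
rewrite !nnegrE (mulr_ge0 (ltW e0) (ler0n _ _)) exprn_ge0 ?powR_ge0// bern.
move=> /(_ isT isT) le1 le2.
have := le_trans le1 le2; rewrite exprMn [D.+1%:R ^+ M.+1]exprS mulrA ler_pM2r ?exprn_gt0//.
apply/negP; rewrite -ltNge.
have Ce0 : 0 <= C / e ^+ M.+1 by rewrite divr_ge0 ?exprn_ge0// ltW.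
have := archi_boundP Ce0; rewrite -/D ltr_pdivrMr ?exprn_gt0// => CD.
apply: (lt_le_trans CD).
by rewrite mulrC ler_pM2l ?exprn_gt0// ler_nat.
Qed.

(** * Transfer to a finite group *)

(** On S, red is injective with inverse lift, and parallelepipeds of H with
    vertices in the image of S lift to G: red is a Freiman isomorphism on S for
    the relations that define parallelepipeds.  The lifted edges are prescribed
    by the lifts of the base point and of its neighbours. *)
Definition freiman_model {G : zmodType} {H : finZmodType} (k : nat) (S : set G)
    (red : {additive G -> H}) (lift : H -> G) : Prop :=
  [/\ cancel lift red, {in S, cancel red lift} &
    forall (a : H) (h : {ffun 'I_k -> H}),
    (forall eps, S (lift (vertex a h eps))) -> forall eps,
    vertex (lift a) [ffun i => lift (a + h i) - lift a] eps =
    lift (vertex a h eps)].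

Lemma vertex_map {G H : zmodType} (red : {additive G -> H}) {k : nat} (a : G)
    (h : {ffun 'I_k -> G}) (eps : {ffun 'I_k -> bool}) :
  red (vertex a h eps) = vertex (red a) [ffun i => red (h i)] eps.
Proof.
rewrite /vertex raddfD raddf_sum; congr (_ + _).
by apply: eq_bigr => i _; rewrite raddfMn ffunE.
Qed.

Lemma vertex0 {G : zmodType} {k : nat} (a : G) (h : {ffun 'I_k -> G}) :
  vertex a h [ffun=> false] = a.
Proof. by rewrite /vertex big1 ?addr0// => i _; rewrite ffunE mulr0n. Qed.

Lemma vertex1 {G : zmodType} {k : nat} (i : 'I_k) (a : G) (h : {ffun 'I_k -> G}) :
  vertex a h [ffun j => j == i] = a + h i.
Proof.
rewrite /vertex (bigD1 i)//= ffunE eqxx mulr1n big1 ?addr0// => j /negbTE ji.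
by rewrite ffunE ji mulr0n.
Qed.

Lemma fsum_parametrized {V : nmodType} {X : choiceType} {T : finType} (L : T -> X)
    (W : X -> V) : injective L -> (forall x, W x != 0 -> exists q, x = L q) ->
  \sum_(x \in [set: X]) W x = \sum_q W (L q).
Proof.
move=> L_inj WL; rewrite (fsbigTE [fset L q | q in T]%fset) => [|x xL]; last first.
  apply/eqP; apply: contraNT xL => /WL[q ->]; exact: in_imfset.
rewrite big_imfset/=; last by move=> ? ? _ _; exact: L_inj.
by rewrite big_enum.
Qed.

Section Transfer.
Context {G : zmodType} {H : finZmodType} {k : nat} {S : set G}.
Context {red : {additive G -> H}} {lift : H -> G}.
Hypothesis model : freiman_model k S red lift.

Let liftK : cancel lift red. Proof. by case: model. Qed.
Let redK x : S x -> lift (red x) = x.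
Proof. by case: model => _ + _ Sx; apply; rewrite inE. Qed.

Lemma fsum_transfer {V : zmodType} (W : G -> V) : supported_in W S ->
  \sum_(x \in [set: G]) W x = \sum_y W (lift y).
Proof.
move=> WS; apply: fsum_parametrized; first exact: can_inj liftK.
by move=> x /WS Sx; exists (red x); rewrite redK.
Qed.

(* The inverse of reduction on parallelepipeds with vertices in S.  It is
   injective everywhere, so a sum over G can be reindexed by it even though
   some of its values leave S. *)
Let lift_pair (q : H * {ffun 'I_k -> H}) : G * {ffun 'I_k -> G} :=
  (lift q.1, [ffun i => lift (q.1 + q.2 i) - lift q.1]).

Let lift_pair_inj : injective lift_pair.
Proof.
move=> [a h] [b g] [/(can_inj liftK) <-] /ffunP hg; congr (_, _).
apply/ffunP => i; have := hg i; rewrite !ffunE.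
by move=> /addIr/(can_inj liftK)/addrI.
Qed.

Let lift_pair_onto (ah : G * {ffun 'I_k -> G}) :
  (forall eps, S (vertex ah.1 ah.2 eps)) ->
  ah = lift_pair (red ah.1, [ffun i => red (ah.2 i)]).
Proof.
case: ah => a h /= vS; rewrite /lift_pair /=.
have Sa : S a by rewrite -(vertex0 a h).
congr (_, _); first by rewrite redK.
have Sh i : S (a + h i) by rewrite -(vertex1 i a h); exact: vS.
apply/ffunP => i; rewrite !ffunE -raddfD (redK _ Sa) (redK _ (Sh i)).
by rewrite addrC addKr.
Qed.

(** A parallelepiped of H that does not have all its vertices in the image of S
    contributes zero on both sides: if the vertices of its lift were all in S,
    reducing them would recover its own vertices. *)
Lemma parallelepiped_transfer {V : comPzRingType}
    (F : {ffun 'I_k -> bool} -> G -> V) : (forall eps, supported_in (F eps) S) ->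
  \sum_(ah \in [set: G * {ffun 'I_k -> G}]) parallelepiped_prod F ah =
  gowers_inner (fun eps y => F eps (lift y)).
Proof.
move=> FS.
have prod_neq0 (X : zmodType) (E : {ffun 'I_k -> bool} -> X -> V)
    (ah : X * {ffun 'I_k -> X}) : parallelepiped_prod E ah != 0 ->
    forall eps, E eps (vertex ah.1 ah.2 eps) != 0.
  move=> Eah eps; apply: contra_neq Eah => E0.
  by rewrite /parallelepiped_prod (bigD1 eps)//= E0 mul0r.
rewrite (fsum_parametrized lift_pair)//; last first.
  move=> ah /prod_neq0 Fah; eexists; apply: lift_pair_onto => eps.
  exact: FS (Fah eps).
apply: eq_bigr => -[a h] _.
have [vS|vNS] := pselect (forall eps, S (lift (vertex a h eps))).
  case: model => _ _ frei; apply: eq_bigr => eps _ /=.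
  by rewrite frei.
transitivity (0 : V); last first.
  apply/esym/eqP; apply: contra_notT vNS => /prod_neq0 Fv eps.
  exact: FS (Fv eps).
apply/eqP; apply: contra_notT vNS => /prod_neq0 Fv eps.
have := FS _ _ (Fv eps) => /= vS.
suff -> : vertex a h eps = red (vertex (lift_pair (a, h)).1 (lift_pair (a, h)).2 eps).
  by rewrite redK.
rewrite vertex_map /= liftK; congr vertex.
by apply/ffunP => i; rewrite !ffunE raddfB /= !liftK addrC addKr.
Qed.

Lemma finite_parallelepipeds :
  finite_set [set ah : G * {ffun 'I_k -> G} | forall eps, S (vertex ah.1 ah.2 eps)].
Proof.
apply: (@sub_finite_set _ _ (lift_pair @` setT)).
  by move=> ah /lift_pair_onto ahE; rewrite ahE; eexists.
by apply: finite_image; exact: finite_finset.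
Qed.

End Transfer.

(** * The norms in terms of finite sums *)

Definition alternate_conj {R : realType} {X : Type} {k : nat} (f : X -> R[i])
    (eps : {ffun 'I_k -> bool}) (x : X) : R[i] :=
  iter (\sum_(i < k) eps i)%N Num.conj (f x).

(** Setting coordinate i of eps to true adds one conjugation, so the upper face
    sum in [gowers_inner_slice] is the conjugate of the lower one.  One direction
    must exist for this, whence the argument i. *)
Lemma alternate_conj_ge0 {R : realType} {H : finZmodType} {k : nat} (i : 'I_k)
    (f : H -> R[i]) :
  0 <= gowers_inner (@alternate_conj R H k f).
Proof.
have H0 : 0 < #|H|%:R :> R[i] by rewrite ltr0n card_finZmod_gt0.
rewrite -(pmulr_rge0 _ H0) (gowers_inner_slice i); apply: sumr_ge0 => h _.
rewrite [X in _ * X](_ : _ = (lower_face_sum i (alternate_conj f) h)^*).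
  exact: mul_conjC_ge0.
rewrite rmorph_sum; apply: eq_bigr => a _; rewrite rmorph_prod.
apply: eq_bigr => eps /negbTE ei; rewrite /alternate_conj -iterS; congr iter.
rewrite (bigD1 i)//= [in RHS](bigD1 i)//= set_coord_at ei add0n add1n.
by congr _.+1; apply: eq_bigr => j /negbTE ji; rewrite ffunE ji.
Qed.

Lemma norm_alternate_conj {R : realType} {X : Type} {k : nat} (f : X -> R[i])
    (eps : {ffun 'I_k -> bool}) x : `|alternate_conj f eps x| = `|f x|.
Proof.
by rewrite /alternate_conj; elim: (\sum_i _)%N => //= m <-; rewrite norm_conjC.
Qed.

Lemma alternate_conj_real {R : realType} {X : Type} {k : nat} (f : X -> R)
    (eps : {ffun 'I_k -> bool}) x :
  alternate_conj (fun x => (f x)%:C%C) eps x = (f x)%:C%C.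
Proof.
rewrite /alternate_conj; elim: (\sum_i _)%N => //= m ->; exact: conjc_real.
Qed.

Lemma gowers_inner_real {R : realType} {H : finZmodType} {k : nat}
    (F : {ffun 'I_k -> bool} -> H -> R) :
  gowers_inner (fun eps x => (F eps x)%:C%C) = (gowers_inner F)%:C%C.
Proof.
by rewrite rmorph_sum; apply: eq_bigr => ah _; rewrite rmorph_prod.
Qed.

Lemma Re_alternate_conj_le {R : realType} {H : finZmodType} {k : nat} (i : 'I_k)
    (f : H -> R[i]) :
  0 <= complex.Re (gowers_inner (@alternate_conj R H k f)) <=
  gowers_power k (fun x => ComplexField.Normc.normc (f x)).
Proof.
set g := gowers_inner _; have g0 : 0 <= g by exact: alternate_conj_ge0.
have gE : g = (complex.Re g)%:C%C by rewrite RRe_real// ger0_real.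
rewrite -!lecR -gE g0 /= -{1}(ger0_norm g0) /gowers_power -gowers_inner_real.
apply: le_trans (ler_norm_sum _ _ _) _; apply: ler_sum => ah _.
rewrite normr_prod; apply: ler_prod => eps _; rewrite normr_ge0 /=.
by rewrite norm_alternate_conj.
Qed.

(** Exponents are compatible because (1 / p) 2^k = t. *)
Lemma powR_root_le {R : realType} (k : nat) (p t X Y : R) : 0 < p ->
  p * t = 2 ^+ k -> 0 <= X -> 0 <= Y ->
  (X `^ (2 ^+ k)^-1 <= Y `^ p^-1) = (X <= Y `^ t).
Proof.
move=> p0 pt X0 Y0; have K0 : (0 < 2 ^ k)%N by rewrite expn_gt0.
rewrite -(@ler_pXn2r _ (2 ^ k)%N)// ?nnegrE ?powR_ge0//.
rewrite (powR_inv_exp k p t)// (powR_inv_exp k (2 ^+ k) 1) ?mulr1 ?exprn_gt0//.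
by rewrite powRr1.
Qed.

Section Norms.
Context {R : realType} {G : zmodType} {H : finZmodType} {k : nat} {S : set G}.
Context {red : {additive G -> H}} {lift : H -> G} {p t : R}.
Hypotheses (k_gt0 : (0 < k)%N) (p_gt0 : 0 < p).
Hypothesis pt : p * t = 2 ^+ k.
Hypothesis model : freiman_model k S red lift.

Lemma lp_norm_transfer (f : G -> R[i]) : supported_in f S ->
  lp_norm p f = (\sum_y ComplexField.Normc.normc (f (lift y)) `^ p) `^ p^-1.
Proof.
move=> fS; rewrite /lp_norm (fsum_transfer model)// => x fx; apply: fS.
by apply: contra_neq fx => ->; rewrite ComplexField.Normc.normc0 powR0// gt_eqF.
Qed.

Lemma gowers_sum_transfer (f : G -> R[i]) : supported_in f S ->
  gowers_sum k f = gowers_inner (@alternate_conj R H k (f \o lift)).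
Proof.
move=> fS; rewrite /gowers_sum; under eq_fsbigr do over.
rewrite -(parallelepiped_transfer model (@alternate_conj R G k f))//.
move=> eps x; rewrite -normr_gt0 norm_alternate_conj normr_gt0; exact: fS.
Qed.

Lemma gowers_norm_le_of_bound (f : G -> R[i]) : supported_in f S ->
  gowers_bound k p t (fun y => S (lift y)) -> gowers_norm k f <= lp_norm p f.
Proof.
move=> fS B; rewrite lp_norm_transfer// /gowers_norm gowers_sum_transfer//.
have /andP[g0 gle] := Re_alternate_conj_le (Ordinal k_gt0) (f \o lift).
rewrite (powR_root_le k p t)// ?sum_powR_ge0//.
apply: le_trans gle (B _ _ _) => y /=; first by rewrite -lecR; exact: (normr_ge0 (f (lift y))).
by move=> fy; apply: fS; apply: contra_neq fy => ->; rewrite ComplexField.Normc.normc0.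
Qed.

Lemma gowers_norm_real_le (f : G -> R) : (forall x, 0 <= f x) -> supported_in f S ->
  (gowers_norm k (fun x => (f x)%:C%C) <= lp_norm p (fun x => (f x)%:C%C)) =
  (gowers_power k (f \o lift) <= (\sum_y f (lift y) `^ p) `^ t).
Proof.
move=> f0 fS; have fCS : supported_in (fun x => (f x)%:C%C) S.
  by move=> x fx; apply: fS; apply: contra_neq fx => ->.
have normE x : ComplexField.Normc.normc (f x)%:C%C = f x.
  by have := ger0_norm (f0 x); rewrite /= expr0n addr0 sqrtr_sqr.
rewrite (lp_norm_transfer _ fCS) /gowers_norm (gowers_sum_transfer _ fCS).
under eq_bigr do rewrite normE.
have -> : gowers_inner (@alternate_conj R H k ((fun x => (f x)%:C%C) \o lift)) =
    (gowers_power k (f \o lift))%:C%C.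
  rewrite /gowers_power -gowers_inner_real; congr gowers_inner.
  by apply/funext => eps; apply/funext => y; exact: alternate_conj_real.
rewrite (powR_root_le k p t)// ?sum_powR_ge0//=.
by apply: gowers_inner_ge0 => eps y /=.
Qed.

(** A function on H supported over S is the transfer of its composite with red,
    cut off outside S. *)
Lemma bound_of_gowers_norm_le :
  (forall f : G -> R, (forall x, 0 <= f x) -> supported_in f S ->
    gowers_norm k (fun x => (f x)%:C%C) <= lp_norm p (fun x => (f x)%:C%C)) ->
  gowers_bound k p t (fun y => S (lift y)).
Proof.
move=> le_norm f f0 fS.
pose g x := if x \in S then f (red x) else 0.
have g0 x : 0 <= g x by rewrite /g; case: ifP => // _; exact: f0.
have gS : supported_in g S.
  by move=> x; rewrite /g; case: ifPn => [/set_mem//|_]; rewrite eqxx.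
have gE y : g (lift y) = f y.
  rewrite /g; case: ifPn => [_|]; first by case: model => ->.
  rewrite notin_setE => nS.
  by apply/esym/eqP; apply: contra_notT nS; exact: fS.
have := le_norm g g0 gS; rewrite (gowers_norm_real_le g g0 gS).
have -> : g \o lift = f by apply/funext.
by under eq_bigr do rewrite gE.
Qed.

Lemma num_parallelepipeds_transfer (A : {fset G}) : (forall x, x \in A -> S x) ->
  (num_parallelepipeds k A)%:R = gowers_power k (fun y => (lift y \in A)%:R) :> R.
Proof.
move=> AS.
pose F (eps : {ffun 'I_k -> bool}) x : R := (x \in A)%:R.
have FS eps : supported_in (F eps) S.
  by move=> x; rewrite /F; case: (boolP (x \in A)) => [/AS//|_]; rewrite eqxx.
rewrite /gowers_power -(parallelepiped_transfer model F FS).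
rewrite /num_parallelepipeds; set P := [set ah | _].
have PE ah : parallelepiped_prod F ah = (ah \in P)%:R.
  rewrite /parallelepiped_prod; have [/set_mem/= aP|] := boolP (ah \in P).
    by rewrite big1// => eps _; rewrite /F aP.
  rewrite notin_setE => /existsNP[eps /negP/negbTE eA].
  by rewrite (bigD1 eps)//= /F eA mul0r.
under eq_fsbigr do rewrite PE.
have Pfin : finite_set P.
  by apply: sub_finite_set (finite_parallelepipeds model) => ah aP eps; exact/AS/aP.
rewrite (fsbigTE (fset_set P)) => [|ah]; last first.
  by rewrite in_fset_set// => /negbTE ->.
rewrite big_seq (eq_bigr (fun=> 1)); last by move=> ah; rewrite in_fset_set// => ->.
by rewrite -big_seq big_const_seq count_predT iter_addr_0.
Qed.

Lemma gowers_norm_indicator_le (A : {fset G}) : (forall x, x \in A -> S x) ->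
  (gowers_norm k (fun x => (x \in A)%:R%:C%C : R[i]) <=
   lp_norm p (fun x => (x \in A)%:R%:C%C : R[i])) =
  ((num_parallelepipeds k A)%:R <= (#|` A|%fset)%:R `^ t :> R).
Proof.
move=> AS; pose f x : R := (x \in A)%:R.
have f0 x : 0 <= f x by exact: ler0n.
have fS : supported_in f S.
  by move=> x; rewrite /f; case: (boolP (x \in A)) => [/AS//|_]; rewrite eqxx.
rewrite (gowers_norm_real_le f f0 fS) (num_parallelepipeds_transfer A AS).
suff -> : \sum_y f (lift y) `^ p = (#|` A|%fset)%:R by [].
rewrite -(fsum_transfer model (fun x => f x `^ p)) => [|x fx]; last first.
  by apply: fS; apply: contra_neq fx => ->; rewrite powR0// gt_eqF.
rewrite (fsbigTE A) => [|x /negbTE xA]; last by rewrite /f xA powR0// gt_eqF.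
rewrite big_seq (eq_bigr (fun=> 1)); last by move=> x xA; rewrite /f xA powR1.
by rewrite -big_seq big_const_seq count_predT iter_addr_0.
Qed.

End Norms.

(** * Residues as models of segments and cubes *)

Lemma row_freiman_model {G : zmodType} {H : finZmodType} {k : nat} {S : set G}
    {red : {additive G -> H}} {lift : H -> G} (d : nat) :
  freiman_model k S red lift ->
  freiman_model k [set v : 'rV[G]_d | forall i, S (v ord0 i)]
    (map_mx red) (map_mx lift).
Proof.
move=> [liftK redK frei].
have vertex_entry (Z : zmodType) (a : 'rV[Z]_d) (h : {ffun 'I_k -> 'rV[Z]_d}) eps i :
    (vertex a h eps) ord0 i = vertex (a ord0 i) [ffun j => h j ord0 i] eps.
  rewrite /vertex mxE summxE; congr (_ + _).
  by apply: eq_bigr => j _; rewrite mulmxnE ffunE.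
split=> [v|v|a h hS eps].
- by apply/rowP => i; rewrite !mxE liftK.
- by rewrite inE => vS; apply/rowP => i; rewrite !mxE redK// inE; exact: vS.
apply/rowP => i; rewrite [RHS]mxE !vertex_entry -frei => [|e].
  by rewrite mxE; congr vertex; apply/ffunP => j; rewrite !ffunE !mxE.
by have := hS e i; rewrite mxE (vertex_entry H a h).
Qed.

Definition residue_int {N : nat} (y : 'Z_N) : int := (y : nat)%:Z.

Lemma intr_Zp_eq0 {N : nat} (x : int) : (1 < N)%N ->
  x%:~R = 0 :> 'Z_N -> `|x| < N%:Z -> x = 0.
Proof.
move=> N1 x0 xN.
have : `|x|%N%:R = 0 :> 'Z_N.
  by case: x x0 {xN} => m //= x0; apply/eqP; rewrite -oppr_eq0; apply/eqP.
move=> /(congr1 val) /=; rewrite val_Zp_nat// modn_small; last by rewrite -ltz_nat.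
by move/eqP; rewrite absz_eq0 => /eqP.
Qed.

(** Let v be a vertex of the lifted parallelepiped and s the lift of the
    corresponding vertex modulo N = (k + 2) n.  They are congruent modulo N.  As
    v differs from the base point by at most k edges of length at most n, and
    the base point differs from s by less than n, their difference is less than
    N in absolute value, hence zero. *)
Lemma int_freiman_model (k n : nat) : (0 < n)%N ->
  @freiman_model int 'Z_(k.+2 * n) k (segment n)
    (intr : {additive int -> 'Z_(k.+2 * n)}) residue_int.
Proof.
move=> n0; have N1 : (1 < k.+2 * n)%N by rewrite (leq_trans (ltn0Sn _ : 1 < 2)%N) // -[2%N]muln1 leq_mul.
have liftK : cancel residue_int (intr : int -> 'Z_(k.+2 * n)).
  by move=> y; rewrite /residue_int -[LHS]/((y : nat)%:R) natr_Zp.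
have redK : {in segment n, cancel (intr : int -> 'Z_(k.+2 * n)) residue_int}.
  case=> m; rewrite inE /segment //= ltz_nat => mn; rewrite /residue_int.
  congr Posz; rewrite -[m%:~R]/(m%:R) val_Zp_nat// modn_small//.
  by rewrite (leq_trans mn)// leq_pmull.
split=> // a h hS eps.
set v := vertex _ _ _; set s := residue_int _.
apply/eqP; rewrite -subr_eq0; apply/eqP; apply: (intr_Zp_eq0 _ N1).
  rewrite intrB /s liftK -[v%:~R]/((intr : {additive int -> 'Z_(k.+2 * n)}) v).
  rewrite vertex_map /= liftK; apply/eqP; rewrite subr_eq0; apply/eqP.
  congr vertex; apply/ffunP => i; rewrite !ffunE intrB !liftK.
  by rewrite addrC addKr.
have Sa : segment n (residue_int a) by have := hS [ffun=> false]; rewrite vertex0.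
have Sh i : segment n (residue_int (a + h i)).
  by have := hS [ffun j => j == i]; rewrite vertex1.
have dist x y : segment n x -> segment n y -> `|x - y| < n%:Z.
  rewrite /segment /= => /andP[x0 xn] /andP[y0 yn].
  by rewrite ltr_norml; apply/andP; split; lia.
have vE : v - s = (residue_int a - s) +
    \sum_(i < k) [ffun i => residue_int (a + h i) - residue_int a] i *+ eps i.
  by rewrite /v /vertex addrAC.
have edges : `|\sum_(i < k) [ffun i => residue_int (a + h i) - residue_int a] i *+ eps i|
    <= (k * n)%:Z.
  apply: le_trans (ler_norm_sum _ _ _) _.
  apply: (@le_trans _ _ (\sum_(i < k) n%:Z)).
    apply: ler_sum => i _; rewrite ffunE; case: (eps i); last by rewrite mulr0n normr0.
    by rewrite mulr1n ltW// dist.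
  by rewrite sumr_const card_ord -mulr_natl natz PoszM.
rewrite vE; apply: le_lt_trans (ler_normD _ _) _.
have := dist _ _ Sa (hS eps); rewrite -/s => base.
apply: lt_le_trans (ltr_leD base edges) _.
by rewrite -PoszD lez_nat -mulSn leq_mul2r leqnSn orbT.
Qed.

(** * The tensor power trick and the equivalence *)

(** The bound for sets in every dimension, with a constant, yields the bound for
    functions in dimension one without it. *)
Lemma gowers_bound_of_sets {R : realType} {Z : finZmodType} (k : nat)
    (p t C : R) (p_gt0 : 0 < p) (t_gt0 : 0 < t) (pt : p * t = 2 ^+ k)
    (C_gt0 : 0 < C) (S : Z -> Prop) :
  (forall (d : nat) (B : {set 'rV[Z]_d}),
    (forall v, v \in B -> forall i, S (v ord0 i)) ->
    gowers_power k (fun v => (v \in B)%:R) <= C * #|B|%:R `^ t) ->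
  gowers_bound k p t S.
Proof.
move=> setB f f0 fS.
apply: (exp_le_of_poly C _ _ (#|Z| * 2 ^ k)) => // [||d]; first exact: gowers_inner_ge0.
  exact: powR_ge0.
rewrite -gowers_power_tensor.
pose cube := [set v : 'rV[Z]_d | [forall i, `[< S (v ord0 i) >]]]%SET.
have cube_sets (B : {set 'rV[Z]_d}) : B \subset cube ->
    gowers_power k (fun v => (v \in B)%:R) <= C * #|B|%:R `^ t.
  move=> /fintype.subsetP BS; apply: setB => v /BS; rewrite inE.
  by move=> /forallP vS i; apply/asboolP.
have in_cube v : tensor_power d f v != 0 -> v \in cube.
  move=> fv; rewrite inE; apply/forallP => i; apply/asboolP/fS.
  by apply: contra_neq fv => fi0; rewrite /tensor_power (bigD1 i)//= fi0 mul0r.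
pose w (c : {ffun Z -> 'I_d.+1}) := \prod_x f x ^+ c x.
have w0 c : 0 <= w c by apply: prodr_ge0 => x _; exact: exprn_ge0.
have := gowers_power_classes k p t C p_gt0 t_gt0 pt C_gt0 cube cube_sets
  (tensor_power d f) letter_counts w in_cube w0
  (fun v _ => tensor_power_counts f v).
rewrite card_ffun card_ord natrX -exprM.
under eq_bigr do rewrite tensor_power_powR//.
rewrite sum_tensor_power -[(\sum_x f x `^ p) ^+ d]powR_mulrn ?sum_powR_ge0//.
by rewrite -powRrM [d%:R * t]mulrC powRrM powR_mulrn ?powR_ge0.
Qed.

Theorem proposition2 (R : realType) (k n : nat) (p t : R)
    (hk : (2 <= k)%N) (hn : (2 <= n)%N) (hp : 0 < p) (ht : 0 < t)
    (hpt : p * t = 2 ^+ k) :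
  [<->
    (forall f : int -> R,
      (forall x, 0 <= f x) -> supported_in f (segment n) ->
      gowers_norm k (fun x => (f x)%:C%C) <= lp_norm p (fun x => (f x)%:C%C));
    (forall (d : nat) (f : 'rV[int]_d -> R[i]),
      supported_in f (@cube n d) ->
      gowers_norm k f <= lp_norm p f);
    (forall (d : nat) (A : {fset 'rV[int]_d}),
      (forall x, x \in A -> cube n x) ->
      (num_parallelepipeds k A)%:R <= (#|` A |%fset)%:R `^ t);
    (exists C : R, 0 < C /\
      forall (d : nat) (A : {fset 'rV[int]_d}),
        (forall x, x \in A -> cube n x) ->
        (num_parallelepipeds k A)%:R <= C * (#|` A |%fset)%:R `^ t)].
Proof.
have k_gt0 : (0 < k)%N by exact: ltnW.
have mod1 := int_freiman_model k n (ltnW hn).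
have modd d := row_freiman_model d mod1.
tfae.
- move=> H1 d f fS.
  have B1 := bound_of_gowers_norm_le hp hpt mod1 H1.
  have Bd := gowers_bound_rV k p t hp hpt _ d B1.
  apply: (gowers_norm_le_of_bound k_gt0 hp hpt (modd d)) fS _.
  move=> g g0 gS; apply: Bd => // v gv i.
  by have := gS v gv i; rewrite mxE.
- move=> H2 d A AS.
  rewrite -(gowers_norm_indicator_le hp hpt (modd d) A AS); apply: H2 => x.
  by case: (boolP (x \in A)) => [/AS//|_]; rewrite eqxx.
- by move=> H3; exists 1; split=> // d A AS; rewrite mul1r; exact: H3.
- move=> [C [C0 H4]].
  have B1 : gowers_bound k p t (fun y : 'Z_(k.+2 * n) => segment n (residue_int y)).
    apply: (gowers_bound_of_sets k p t C) => // d B BS.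
    have lift_inj : injective (map_mx residue_int : 'rV['Z_(k.+2 * n)]_d -> _).
      by case: (modd d) => liftK _ _; exact: can_inj liftK.
    pose A := [fset map_mx residue_int v | v in B]%fset.
    have AS x : x \in A -> cube n x.
      by move=> /imfsetP[v /= vB ->] i; rewrite mxE; exact: BS.
    have := H4 d A AS; rewrite (num_parallelepipeds_transfer (modd d) A AS).
    rewrite card_imfset//= -cardE.
    suff -> : (fun y => (map_mx residue_int y \in A)%:R) = (fun v => (v \in B)%:R) :> (_ -> R) by [].
    apply/funext => v; congr (_ : bool)%:R; apply/imfsetP/idP => [[u /= uB /lift_inj ->//]|vB].
    by exists v.
  move=> f f0 fS.
  have fCS : supported_in (fun x => (f x)%:C%C) (segment n).
    by move=> x fx; apply: fS; apply: contra_neq fx => ->.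
  exact: (gowers_norm_le_of_bound k_gt0 hp hpt mod1) fCS B1.
Qed.
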